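(* Consider a Cayley-Klein space of dimension $n$ and let $K$ be a subspace of $P^n(\mathbb{R})$. Then the set of all total polars of $K$ is a Schubert variety.
   Context: Conventions. Subspaces are projective subspaces, including $\varnothing$ (of dimension $-1$) and the whole space; $\dim$ is projective dimension; $S+T$ is the smallest subspace containing $S$ and $T$; a point $X$ is identified with $\{X\}$. A hyperplane of a subspace $S$ is a subspace of $S$ of dimension $\dim S-1$. A set of points is independent if representing vectors are linearly independent; a set of hyperplanes is independent if the linear forms defining them are linearly independent. The intersection of the empty family of hyperplanes is the whole space. Quadrics. A quadric $Q$ in a real projective space $P(V)$ is the set $\{[x] : f(x,x)=0\}$ for a symmetric bilinear form $f$ on $V$ that is not identically zero; it is considered together with $f$. Points $[x],[y]$ are conjugate with respect to $Q$ if $f(x,y)=0$. The polar of a subspace $K$ with respect to $Q$ is the set of all points of $P(V)$ conjugate to every point of $K$. The vertex of $Q$ is the polar of $P(V)$; $Q$ is non-degenerate if its vertex is empty. Cayley-Klein space. Put $A_0=P^n(\mathbb{R})$. A Cayley-Klein space of dimension $n$ is $P^n(\mathbb{R})$ with a sequence $Q_0,A_1,Q_1,A_2,\dots,A_r,Q_r,A_{r+1}=\varnothing$ such that, for $0\le i\le r$, $Q_i$ is a quadric in $A_i$ with vertex $A_{i+1}$. Its absolute figure is the sequence of complex extensions $\hat Q_0\supseteq\hat A_1\supseteq\hat Q_1\supseteq\cdots\supseteq\hat A_r\supseteq\hat Q_r\supseteq\hat A_{r+1}=\varnothing$. For a subspace $K$ of $P^n(\mathbb{R})$, $(K\cap A_j)^{p_j}\subseteq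 A_j$ denotes the polar of $K\cap A_j$ with respect to the quadric $Q_j$ in $A_j$. Total polars. If $X$ is a point with $X\in A_l\setminus A_{l+1}$, a total polar of $X$ is a hyperplane of $P^n(\mathbb{R})$ containing $X^{p_l}$ (the polar of $X$ in $A_l$ with respect to $Q_l$). If $K$ is a $k$-dimensional subspace, a total polar of $K$ is an $(n-k-1)$-dimensional subspace of the form $\bigcap_{i=0}^k H_i$, where $\{X_0,\dots,X_k\}$ is some independent subset $B$ of $K$ with $|B\cap A_j|=\dim(K\cap A_j)+1$ for $0\le j\le r$, each $H_i$ is a total polar of $X_i$, and $\{H_0,\dots,H_k\}$ is independent. ($P^n(\mathbb{R})$ and $\varnothing$ are total polar to each other.) Schubert variety. For a strictly increasing sequence $\varnothing=W_{-1}\subsetneq W_0\subsetneq\cdots\subsetneq W_k$ of subspaces of a projective space, the associated Schubert variety is the set of all $k$-dimensional subspaces $L$ with $\dim(L\cap W_i)\ge i$ for $0\le i\le k$. *)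

(* Defs.v *)
From HB Require Import structures.
From mathcomp Require Import all_boot all_order all_algebra reals.

Set Implicit Arguments.
Unset Strict Implicit.
Unset Printing Implicit Defensive.

Import Order.TTheory GRing.Theory Num.Theory.
Local Open Scope ring_scope.

(* P^n(R) is the projective space of V = 'rV[R]_n.+1.  A projective subspace is
   represented by the linear subspace S : {vspace V} it comes from, so that its
   projective dimension is \dim S - 1, the empty subspace is 0%VS, the whole
   space is fullv, and a point is a subspace with \dim = 1.  The join and the
   intersection are (S + T)%VS and (S :&: T)%VS. *)

Section Polar.
Variables (F : fieldType) (V : vectType F).

(* The polar, inside A, of K :&: A with respect to the quadric of A given by f:
   [orthov] is taken in the vector space A, then embedded back into V. *)
Definition polar (A : {vspace V}) (f : {symmetric (subvs_of A)})
    (K : {vspace V}) : {vspace V} :=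
  let iota : 'Hom(subvs_of A, V) := linfun vsval in
  (iota @: orthov f (iota @^-1: K))%VS.

Definition indep_points (m : nat) (X : 'I_m -> {vspace V}) : Prop :=
  exists2 x : 'I_m -> V,
    free [tuple x i | i < m] & forall i, X i = <[x i]>%VS.

Definition indep_hyperplanes (m : nat) (H : 'I_m -> {vspace V}) : Prop :=
  exists2 phi : 'I_m -> 'Hom(V, F^o),
    free [tuple phi i | i < m] & forall i, H i = lker (phi i).

Definition proper_subv (S T : {vspace V}) : bool := (S <= T)%VS && (S != T).

(* W lists W_0, ..., W_k, so that size W = k + 1; W = [::] is the case k = -1.
   The conditions dim L = k and dim (L :&: W_i) >= i are on projective
   dimensions. *)
Definition schubert (W : seq {vspace V}) (L : {vspace V}) : Prop :=
  \dim L = size W /\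
  forall i, (i < size W)%N -> (i.+1 <= \dim (L :&: nth 0%VS W i))%N.

Definition is_schubert_variety (S : {vspace V} -> Prop) : Prop :=
  exists2 W : seq {vspace V},
    path proper_subv 0%VS W & forall L, S L <-> schubert W L.

End Polar.

(* Each quadric Q_i of A_i is given by its form ck_form i; only the indices
   i <= ck_r (and i = ck_r.+1 for ck_A) are meaningful. *)
Record cayley_klein (R : realType) (n : nat) := CayleyKlein {
  ck_r : nat;
  ck_A : nat -> {vspace 'rV[R]_n.+1};
  ck_form : forall i, {symmetric (subvs_of (ck_A i))};
  ck_A0 : ck_A 0 = fullv;
  ck_Alast : ck_A ck_r.+1 = 0%VS;
  ck_form_neq0 : forall i, (i <= ck_r)%N -> exists x y, ck_form i x y != 0;
  ck_vertex : forall i, (i <= ck_r)%N ->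
    polar (ck_form i) (ck_A i) = ck_A i.+1
}.

Section TotalPolar.
Variables (R : realType) (n : nat) (C : cayley_klein R n).
Implicit Types X H K L : {vspace 'rV[R]_n.+1}.

Definition total_polar_point X H : Prop :=
  [/\ \dim X = 1%N, (\dim H).+1 = \dim (fullv : {vspace 'rV[R]_n.+1}) &
      exists l : nat, [/\ (l <= ck_r C)%N, (X <= ck_A C l)%VS,
        ~~ (X <= ck_A C l.+1)%VS & (polar (ck_form C l) X <= H)%VS]].

(* B = {X_0, ..., X_k} is given as a family indexed by 'I_(\dim K), where
   \dim K = k + 1; it is injective by independence.  The condition on the
   projective dimensions of K and L reads \dim L + \dim K = n + 1. *)
Definition total_polar K L : Prop :=
  (\dim L + \dim K = n.+1)%N /\
  exists X : 'I_(\dim K) -> {vspace 'rV[R]_n.+1},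
  exists H : 'I_(\dim K) -> {vspace 'rV[R]_n.+1},
  [/\ indep_points X /\ (forall i, (X i <= K)%VS),
      forall j : nat, (j <= ck_r C)%N ->
        #|[set i | (X i <= ck_A C j)%VS]| = \dim (K :&: ck_A C j),
      forall i, total_polar_point (X i) (H i),
      indep_hyperplanes H
    & L = (\bigcap_i H i)%VS].

End TotalPolar.

(* Main.v *)
From HB Require Import structures.
Require Import Defs.
From mathcomp Require Import all_boot all_order all_algebra reals.
From mathcomp Require Import zify.

(* Let A_0, A_1, ... be the flag of the space, K_l = K :&: A_l, and let T_l be
   the polar of K_l in A_l.  The total polars of K are the L of dimension
   dim V - dim K such that dim (L :&: T_l) >= dim T_l - dim K_{l+1} for all
   l <= r.  Since the T_l decrease and both these bounds and the numbers
   dim K_{l+1} are nonincreasing in l, filling in the flag of the T_l with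
   intermediate subspaces turns these conditions into Schubert conditions.

   Necessity: if the point X_i has level at most l, then H_i contains the polar
   of X_i, hence T_l; so L :&: T_l is cut out of T_l by the other hyperplanes,
   and there are dim K_{l+1} of those.

   Sufficiency: identify V with its dual by the dot product, so that hyperplanes
   are given by vectors and perp T_l = perp A_l + h K_l, with h the Gram map of
   the l-th form.  The conditions say that perp L meets each perp T_l in a large
   subspace.  Going up the levels, extend the vectors already chosen in
   perp L :&: perp A_l by new ones in perp L :&: perp T_l: first by vectors of
   perp A_l, whose hyperplanes contain A_l and are total polars of any point of
   level l, then by vectors independent modulo perp A_l.  The latter agree modulo
   perp A_l with h y for vectors y of K_l independent modulo K_{l+1}, which are
   completed to a basis of K_l modulo K_{l+1} to be paired with the former. *)

Set Implicit Arguments.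
Unset Strict Implicit.
Unset Printing Implicit Defensive.

Import Order.TTheory GRing.Theory Num.Theory.
Local Open Scope ring_scope.

(* Dimensions of equal subspaces may differ by a canonical instance hidden under
   [reverse_coercion], which [lia] would treat as distinct atoms. *)
Local Ltac dim_lia := unfold reverse_coercion in *; lia.


(** * Dimensions, intermediate subspaces and relative bases *)

Section VectorSpaces.
Variables (F : fieldType) (vT : vectType F).
Implicit Types (S T U K L M N : {vspace vT}) (X : seq vT).

Lemma dim_cap_hyperplane U (phi : 'Hom(vT, F^o)) :
  (\dim U <= (\dim (U :&: lker phi)).+1)%N.
Proof.
rewrite -(limg_ker_dim phi U) -addn1 leq_add2l.
by rewrite (leq_trans (dimvS (subvf _))) // dimvf.
Qed.

Lemma dim_cap_hyperplanes (I : finType) (P : pred I)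
    (phi : I -> 'Hom(vT, F^o)) U :
  (\dim U <= \dim (U :&: \bigcap_(i | P i) lker (phi i)) + #|P|)%N.
Proof.
rewrite -big_filter.
have <- : size [seq i <- index_enum I | P i] = #|P|.
  by rewrite -sum1_card -sum1_size big_filter.
elim: [seq _ <- _ | _] U => [|i s IHs] U; first by rewrite big_nil capvf addn0.
rewrite big_cons capvA addnS; apply: leq_trans (dim_cap_hyperplane U (phi i)) _.
by rewrite ltnS; apply: IHs.
Qed.

(** The quotient of [L :&: T] by [L :&: S] embeds into that of [T] by [S]. *)
Lemma dim_capv_mono S T L : (S <= T)%VS ->
  (\dim (L :&: T) + \dim S <= \dim (L :&: S) + \dim T)%N.
Proof.
move=> sST.
have := dimv_sum_cap (L :&: T) S.
rewrite -capvA (capv_idPr sST) => eq1.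
have : (\dim (L :&: T + S) <= \dim T)%N by rewrite dimvS // subv_add capvSr.
lia.
Qed.

Lemma diffv_basis S T : (S <= T)%VS ->
  exists X, basis_of T (X ++ vbasis S).
Proof.
move=> sST; exists (vbasis (T :\: S)).
have {1}-> : T = (T :\: S + S)%VS by rewrite addv_diff; apply/esym/addv_idPl.
by apply: cat_basis; [apply/directv_addP/capv_diff | |]; apply: vbasisP.
Qed.

Lemma size_basis_seq U X : basis_of U X -> size X = \dim U.
Proof. by move=> bX; rewrite (size_basis (X := in_tuple X) bX). Qed.

Lemma subv_between S T d : (S <= T)%VS -> (\dim S <= d <= \dim T)%N ->
  exists2 U, (S <= U)%VS && (U <= T)%VS & \dim U = d.
Proof.
move=> sST /andP[leSd ledT]; have [X bX] := diffv_basis sST.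
have sz : size X = (\dim T - \dim S)%N.
  by have := size_basis_seq bX; rewrite size_cat size_tuple; lia.
(* The last [d - \dim S] vectors of [X] are kept, so that [Y] is a suffix of [X ++ vbasis S] and
   inherits its freeness. *)
pose Y := drop (size X - (d - \dim S)) X ++ vbasis S.
have frY : free Y.
  have := basis_free bX; rewrite -{1}(cat_take_drop (size X - (d - \dim S)) X).
  by rewrite -catA => /catr_free.
exists <<Y>>%VS.
  rewrite /Y span_cat (span_basis (vbasisP S)) addvSr /= subv_add sST andbT.
  rewrite -(span_basis bX); apply: sub_span => x /mem_drop xX.
  by rewrite mem_cat xX.
by rewrite (eqP frY) size_cat size_drop size_tuple sz; lia.
Qed.

(** Independence of [X] modulo [K] is expressed throughout as freeness of [X ++ vbasis K]; this is
    the link with coefficients. *)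
Lemma cat_free_modP m (X : m.-tuple vT) K :
  (forall k : 'I_m -> F, \sum_i k i *: X`_i \in K -> forall i, k i = 0) <->
  free (X ++ vbasis K).
Proof.
rewrite cat_free (basis_free (vbasisP K)) (span_basis (vbasisP K)) /=.
split=> [H | /andP[/freeP frX /directv_addP dXK] k kK i].
  apply/andP; split.
    by apply/freeP => k k0; apply: H; rewrite k0 mem0v.
  apply/directv_addP/eqP; rewrite -subv0; apply/subvP => v.
  rewrite memv_cap memv0 => /andP[/coord_span ->] /H k0.
  by rewrite big1 // => i _; rewrite k0 scale0r.
apply: frX; apply/eqP; rewrite -memv0 -dXK memv_cap kK andbT.
by apply: memv_suml => j _; apply/memvZ/memv_span/mem_nth; rewrite size_tuple.
Qed.

End VectorSpaces.

(** Take [C] a basis of [M] modulo [M :&: N] and [B] one of [M :&: N] modulo [U]. Each vector of [C]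
    agrees modulo [N] with some [h y], and these [y] are independent modulo [K']; they are paired
    with [C]. The vectors [D] completing them to a basis of [K] modulo [K'] are paired with [B]. *)
Lemma adapted_bases (F : fieldType) (vT wT : vectType F) (h : 'Hom(vT, wT))
    (K K' : {vspace vT}) (M N U : {vspace wT}) :
    (K' <= K)%VS -> (h @: K' <= N)%VS -> (M <= N + h @: K)%VS ->
    (U <= M :&: N)%VS -> (\dim M + \dim K' = \dim U + \dim K)%N ->
  exists X Y,
    [/\ size X = size Y, basis_of K (X ++ vbasis K'),
        basis_of M (Y ++ vbasis U) &
        forall i, (i < size X)%N -> Y`_i \in (N + <[h X`_i]>)%VS].
Proof.
move=> sK'K hK'N sMNK sUMN dimM.
have [C bC] := diffv_basis (capvSl M N).
have [B bB] := diffv_basis sUMN.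
have /(fin_all_exists (T := 'I_(size C))) [y Py] (i : 'I_(size C)) :
    exists y, y \in K /\ C`_i - h y \in N.
  have /(subvP sMNK)/memv_addP[v vN [w /memv_imgP[y yK ->] ->]] : C`_i \in M.
    by rewrite (basis_mem bC) // mem_cat mem_nth.
  by exists y; rewrite addrK.
pose Z := [tuple y i | i < size C].
have ZE (i : 'I_(size C)) : Z`_i = y i by rewrite -tnth_nth tnth_mktuple.
have /cat_free_modP frC : free (in_tuple C ++ vbasis (M :&: N)) := basis_free bC.
have frZ : free (Z ++ vbasis K').
  apply/cat_free_modP => k kK'; apply: frC => /=; rewrite memv_cap.
  rewrite memv_suml => [|i _] /=; last first.
    by rewrite memvZ // (basis_mem bC) // mem_cat mem_nth.
  (* If a combination of the [y i] lies in [K'], its image lies in [N], so the same combination of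
     [C] lies in [M :&: N] and must be trivial. *)
  have -> : \sum_i k i *: C`_i =
      \sum_i k i *: (C`_i - h (y i)) + h (\sum_i k i *: Z`_i).
    rewrite linear_sum -big_split /=; apply: eq_bigr => i _.
    by rewrite linearZ -scalerDr ZE subrK.
  rewrite memvD ?(subvP hK'N _ (memv_img _ kK')) //.
  by apply: memv_suml => i _; rewrite memvZ //; case: (Py i).
pose Q := <<Z ++ vbasis K'>>%VS.
have sQK : (Q <= K)%VS.
  apply/span_subvP => v; rewrite mem_cat => /orP[/tnthP[i ->]|/vbasis_mem/(subvP sK'K) //].
  by rewrite tnth_mktuple; case: (Py i).
pose D := vbasis (K :\: Q).
have bK : basis_of K (D ++ (Z ++ vbasis K')).
  have {1}-> : K = (K :\: Q + Q)%VS by rewrite addv_diff; apply/esym/addv_idPl.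
  apply: cat_basis; [exact/directv_addP/capv_diff | exact: vbasisP |].
  by rewrite /basis_of eqxx frZ.
have szC := size_basis_seq bC.
have szB := size_basis_seq bB.
have szK := size_basis_seq bK.
rewrite !size_cat !size_tuple in szC szB szK.
have szZ : size Z = size C by rewrite size_tuple.
(* The hypothesis [dimM] is exactly what makes [D] and [B] equally long. *)
have szD : \dim (K :\: Q) = size B by lia.
exists (Z ++ D), (C ++ B); split.
- by rewrite !size_cat !size_tuple; congr (_ + _)%N; exact: szD.
- by rewrite (perm_basis (Y := D ++ (Z ++ vbasis K'))) // -catA perm_catCA.
- have {1}-> : M = (<<C>> + (M :&: N))%VS.
    by rewrite -(span_basis (vbasisP (M :&: N)%VS)) -span_cat (span_basis bC).
  rewrite -catA; apply: cat_basis bB.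
    have := basis_free bC; rewrite cat_free => /and3P[_ _].
    by rewrite (span_basis (vbasisP _)).
  by rewrite /basis_of eqxx (catl_free (basis_free bC)).
move=> i; rewrite size_cat !nth_cat szZ => lti.
case: ltnP => [ltiC | leCi].
  rewrite (ZE (Ordinal ltiC)).
  rewrite -(subrK (h (y (Ordinal ltiC))) C`_i) memv_add ?memv_line //.
  by have [] := Py (Ordinal ltiC).
(* Vectors of [B] already lie in [N], so any partner is allowed. *)
suff: B`_(i - size C) \in (M :&: N)%VS.
  by rewrite memv_cap => /andP[_]; apply/subvP/addvSl.
rewrite (basis_mem bB) // mem_cat mem_nth //.
by rewrite ltn_subLR -?szD; first by move: lti; rewrite (size_tuple D).
Qed.

(** * From dimension conditions along a chain to Schubert varieties *)

Section SchubertConditions.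
Variables (F : fieldType) (vT : vectType F).
Implicit Types (S T L : {vspace vT}) (W : seq {vspace vT}).

(** The requirement on [\dim L] is left out, since a flag under construction may be shorter than
    [\dim L]. *)
Definition schubert_cond W L :=
  forall i, (i < size W)%N -> (i < \dim (L :&: nth 0%VS W i))%N.

Lemma schubert_cond_rcons W T L :
  schubert_cond (rcons W T) L <->
  schubert_cond W L /\ (size W < \dim (L :&: T))%N.
Proof.
split=> [H | [H ltT] i]; last first.
  rewrite size_rcons ltnS nth_rcons leq_eqVlt => /predU1P[->|ltiW].
    by rewrite ltnn eqxx.
  by rewrite ltiW; apply: H.
split=> [i ltiW|].
  by have := H i; rewrite size_rcons nth_rcons ltiW; apply; apply: ltnW.
by have := H (size W); rewrite size_rcons nth_rcons ltnn eqxx; apply.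
Qed.

Lemma schubert_cond_last W L :
  schubert_cond W L -> (size W <= \dim (L :&: last 0%VS W))%N.
Proof.
case/lastP: W => // W T /schubert_cond_rcons[_].
by rewrite last_rcons size_rcons.
Qed.

(* The flag is refined downwards from T: a condition dim (L :&: T) >= d.+1
   already gives dim (L :&: S) >= d for every hyperplane S of T. *)
Lemma schubert_cond_extend W T d :
    path (@proper_subv F vT) 0%VS W -> (last 0%VS W <= T)%VS ->
    (\dim (last 0%VS W) + d <= \dim T)%N ->
  exists W', [/\ path (@proper_subv F vT) 0%VS W', (last 0%VS W' <= T)%VS,
    size W' = (size W + d)%N &
    forall L, schubert_cond W' L <->
      schubert_cond W L /\ (size W + d <= \dim (L :&: T))%N].
Proof.
elim: d T => [|d IHd] T pathW sWT ledT.
  exists W; split=> //; first by rewrite addn0.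
  move=> L; split=> [H | []] //; split=> //; rewrite addn0.
  by rewrite (leq_trans (schubert_cond_last H)) // dimvS // capvS.
have [|S /andP[sWS sST] dimS] := subv_between (d := (\dim T).-1) sWT; first lia.
have [|W' [pathW' sW'S sizeW' condW']] := IHd S pathW sWS; first lia.
exists (rcons W' T); split.
- rewrite rcons_path pathW' /proper_subv (subv_trans sW'S sST) /=.
  (* The inclusion in [T] is proper because the last member of [W'] lies in the hyperplane [S] of
     [T]. *)
  apply: contraTneq sW'S => ->; apply/negP => /dimvS; lia.
- by rewrite last_rcons.
- by rewrite size_rcons sizeW' addnS.
move=> L; rewrite schubert_cond_rcons condW' sizeW' -addnS.
split=> [[[]]|[HW HT]] //; split=> //; split=> //.
have := dim_capv_mono L sST; lia.
Qed.

(** The flag is built from the smallest subspace [T m] up to [T 0], with [e i] members inside [T i].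
    The third hypothesis says that there is room for [e i - e i.+1] further members between [T i.+1]
    and [T i]. *)
Lemma is_schubert_variety_of_conditions m (T : nat -> {vspace vT})
    (e : nat -> nat) :
    (forall i, (i < m)%N -> (T i.+1 <= T i)%VS) ->
    (forall i, (i < m)%N -> (e i.+1 <= e i)%N) ->
    (forall i, (i < m)%N -> (\dim (T i.+1) + e i <= \dim (T i) + e i.+1)%N) ->
    (e m <= \dim (T m))%N ->
  is_schubert_variety (fun L => \dim L = e 0%N /\
    forall i, (i <= m)%N -> (e i <= \dim (L :&: T i))%N).
Proof.
move=> Tdecr edecr Tedecr emT.
suff flag : forall j, (j <= m)%N ->
    exists W, [/\ path (@proper_subv F vT) 0%VS W,
      (last 0%VS W <= T (m - j)%N)%VS, size W = e (m - j)%N &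
      forall L, schubert_cond W L <->
        forall i, (m - j <= i <= m)%N -> (e i <= \dim (L :&: T i))%N].
  have [W [pathW _ sizeW condW]] := flag m (leqnn m); rewrite subnn in sizeW condW.
  exists W => // L; rewrite /schubert sizeW.
  have [WT TW] := condW L.
  split=> -[dimL condL]; split=> //.
    by move: (TW condL); rewrite /schubert_cond sizeW.
  by apply: WT; rewrite /schubert_cond sizeW.
elim=> [|j IHj] lejm.
  have [|||W] := @schubert_cond_extend [::] (T m) (e m) => //.
  - exact: sub0v.
  - by rewrite dimv0.
  rewrite subn0 => -[pathW sWT sizeW condW]; exists W; split=> // L.
  rewrite condW; split=> [[_ H] i|H].
    by rewrite -eqn_leq => /eqP <-.
  by split=> //; apply: H; rewrite leqnn.
have [W [pathW sWT sizeW condW]] := IHj (ltnW lejm).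
move: sWT sizeW condW; have -> : (m - j = (m - j.+1).+1)%N by lia.
set l := (m - j.+1)%N => sWT sizeW condW; have ltlm : (l < m)%N by rewrite /l; lia.
have := (Tdecr l ltlm, edecr l ltlm, Tedecr l ltlm) => -[[Tl el] Tel].
have dimW := dimvS sWT.
have [|||W'] := @schubert_cond_extend W (T l) (e l - size W) => //.
- exact: subv_trans sWT Tl.
- lia.
rewrite subnKC ?sizeW // => -[pathW' sW'T sizeW' condW']; exists W'; split=> // L.
rewrite condW' condW; split=> [[H eT] i /andP[]|H].
  by rewrite leq_eqVlt => /predU1P[<- //|ltli leim]; apply: H; rewrite ltli.
split=> [i /andP[ltli leim]|]; apply: H; lia.
Qed.

End SchubertConditions.


(** * Orthogonality for the dot product *)

Section DotProduct.
Variables (R : realType) (n : nat).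
Local Notation V := 'rV[R]_n.
Implicit Types (u v a : V) (S T U : {vspace V}).

Definition dotp u v : R := (u *m v^T) 0 0.

Lemma dotpE u v : dotp u v = \sum_i u 0 i * v 0 i.
Proof. by rewrite /dotp mxE; apply: eq_bigr => i _; rewrite mxE. Qed.

Lemma dotpC u v : dotp u v = dotp v u.
Proof. by rewrite !dotpE; apply: eq_bigr => i _; rewrite mulrC. Qed.

Lemma dotp_linearl v : linear_for *%R (dotp^~ v).
Proof.
move=> k u w /=; rewrite !dotpE mulr_sumr -big_split /=.
by apply: eq_bigr => i _; rewrite !mxE mulrDl mulrA.
Qed.

Lemma dotp_bilinear : bilinear_for
  (GRing.Scale.Law.clone _ _ ( *%R ) _) (GRing.Scale.Law.clone _ _ (idfun \; *%R) _)
  dotp.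
Proof.
split=> u k v w /=; first exact: dotp_linearl.
by rewrite ![dotp u _]dotpC dotp_linearl.
Qed.

HB.instance Definition _ := bilinear_isBilinear.Build R V V R
  (GRing.Scale.Law.clone _ _ ( *%R ) _) (GRing.Scale.Law.clone _ _ (idfun \; *%R) _)
  dotp dotp_bilinear.

Lemma dotp_symmetric u v : dotp u v = (-1) ^+ false * idfun (dotp v u).
Proof. by rewrite expr0 mul1r dotpC. Qed.

HB.instance Definition _ :=
  isHermitianSesquilinear.Build R V false idfun dotp dotp_symmetric.

Definition perp (S : {vspace V}) : {vspace V} := orthov dotp S.

Lemma perpP S u : reflect (forall v, v \in S -> dotp u v = 0) (u \in perp S).
Proof. exact: mem_orthovP. Qed.

Definition covec a : 'Hom(V, R^o) := linfun (applyr dotp a : V -> R^o).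

Lemma covecE a v : covec a v = dotp v a.
Proof. by rewrite lfunE. Qed.

Lemma lker_covec a : lker (covec a) = perp <[a]>.
Proof. by rewrite /perp orthov1E. Qed.

Lemma dotp_eq0 u : (dotp u u == 0) = (u == 0).
Proof.
apply/idP/eqP => [|->]; last by rewrite dotpE big1 // => i _; rewrite mxE mul0r.
rewrite dotpE psumr_eq0 => [/allP u0|i _]; last by rewrite -expr2 sqr_ge0.
apply/rowP => i; rewrite mxE; apply/eqP.
by have := u0 i (mem_index_enum i); rewrite mulf_eq0 orbb.
Qed.

(** One inequality comes from positive definiteness, which makes [perp S] and [S] disjoint; the
    other holds because [perp S] is cut out by [\dim S] hyperplanes, one for each vector of a basis
    of [S]. *)
Lemma dim_perp S : (\dim (perp S) + \dim S)%N = n.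
Proof.
have dimV : \dim {:V} = n by rewrite dimvf /= /dim /= mul1n.
apply/eqP; rewrite eqn_leq; apply/andP; split.
  rewrite -dimv_sum_cap.
  suff -> : (perp S :&: S = 0)%VS by rewrite dimv0 addn0 -[leqRHS]dimV dimvS ?subvf.
  apply/eqP; rewrite -subv0; apply/subvP => u.
  rewrite memv_cap memv0 -dotp_eq0 => /andP[/perpP Su uS].
  by rewrite Su.
rewrite -{1}dimV -[X in (_ <= \dim X + _)%N]capfv.
have := dim_cap_hyperplanes predT (fun i : 'I_(\dim S) => covec (vbasis S)`_i) fullv.
by rewrite cardT size_enum_ord.
Qed.

Lemma perpK S : perp (perp S) = S.
Proof.
apply/esym/eqP; rewrite eqEdim; apply/andP; split.
  by rewrite /perp orthov_sym.
have := dim_perp S; have := dim_perp (perp S); lia.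
Qed.

Lemma perpS S T : (S <= T)%VS -> (perp T <= perp S)%VS.
Proof. by move=> sST; apply/subvP => u /perpP uT; apply/perpP => v /(subvP sST)/uT. Qed.

Lemma perpD S T : perp (S + T) = (perp S :&: perp T)%VS.
Proof.
apply/eqP; rewrite eqEsubv subv_cap !perpS ?addvSl ?addvSr //=.
rewrite /perp orthov_sym subv_add -/(perp _).
by rewrite orthov_sym capvSl orthov_sym capvSr.
Qed.

Lemma perp_cap S T : perp (S :&: T) = (perp S + perp T)%VS.
Proof. by rewrite -[RHS]perpK perpD !perpK. Qed.

Lemma covec_free m (a : 'I_m -> V) :
  free [tuple a i | i < m] -> free [tuple covec (a i) | i < m].
Proof.
move=> /freeP fra; apply/freeP => k k0; apply: fra.
(* A vanishing combination of the forms is the pairing with [w]; its value at [w] is [dotp w w]. *)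
set w := (X in X = 0); apply/eqP; rewrite -dotp_eq0.
have := congr1 (fun f : 'Hom(V, R^o) => f w) k0; rewrite sum_lfunE lfunE /= => <-.
rewrite {2}/w linear_sumr; apply/eqP/eq_bigr => i _.
rewrite scale_lfunE !nth_mktuple covecE.
by rewrite linearZr_LR.
Qed.

End DotProduct.


(** * Polars with respect to a form on a subspace *)

Section Polar.
Variables (F : fieldType) (V : vectType F).
Variables (A : {vspace V}) (f : {symmetric (subvs_of A)}).
Implicit Types K L : {vspace V}.

Lemma polarP K v :
  reflect (v \in A /\ forall u, u \in (K :&: A)%VS -> f (vsproj A v) (vsproj A u) = 0)
          (v \in polar f K).
Proof.
rewrite /polar; apply: (iffP memv_imgP) => [[w /mem_orthovP wK ->]|[vA vK]].
  rewrite lfunE /= subvsP; split=> // u /[!memv_cap] /andP[uK uA].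
  rewrite vsvalK; apply: wK.
  by rewrite -memv_preim lfunE /= vsprojK.
exists (vsproj A v); last by rewrite lfunE /= vsprojK.
apply/mem_orthovP => w; rewrite -memv_preim lfunE /= => wK.
by rewrite -(vsvalK w); apply: vK; rewrite memv_cap wK subvsP.
Qed.

Lemma polar_sub K : (polar f K <= A)%VS.
Proof. by apply/subvP => v /polarP[]. Qed.

Lemma polarS K L : (K :&: A <= L)%VS -> (polar f L <= polar f K)%VS.
Proof.
move=> sKL; apply/subvP => v /polarP[vA vL]; apply/polarP; split=> // u uK.
by apply: vL; apply: subvP uK; rewrite subv_cap sKL capvSr.
Qed.

Lemma vsproj_projv v : vsproj A (projv A v) = vsproj A v.
Proof.
apply/val_inj; rewrite /= vsprojK ?memv_proj //.
by rewrite [vsproj _]unlock.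
Qed.

End Polar.

(** * The Gram map and orthogonals of polars *)

Section Gram.
Variables (R : realType) (n : nat).
Local Notation V := 'rV[R]_n.
Variables (A : {vspace V}) (f : {symmetric (subvs_of A)}).
Implicit Types K : {vspace V}.

(** The form is extended to the whole space through [vsproj A]; [gram_fun y] is the vector whose dot
    products give the pairing with [y]. *)
Definition gram_fun (y : V) : V :=
  \row_j f (vsproj A y) (vsproj A (delta_mx 0 j)).

Lemma gram_fun_linear : linear gram_fun.
Proof.
by move=> k y z; apply/rowP => j; rewrite !mxE !linearP linearPl.
Qed.

HB.instance Definition _ := GRing.isLinear.Build R V V _ gram_fun gram_fun_linear.

Definition gram : 'End(V) := linfun gram_fun.

Lemma dotp_gram y v : dotp (gram y) v = f (vsproj A y) (vsproj A v).
Proof.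
rewrite {2}(row_sum_delta v) !linear_sum dotpE; apply: eq_bigr => j _.
by rewrite !linearZ lfunE /= mxE mulrC.
Qed.

Lemma lker_gram v : v \in A -> (v \in lker gram) = (v \in polar f A).
Proof.
move=> vA; rewrite memv_ker; apply/eqP/polarP => [gv0 | [_ vA0]].
  by split=> // u _; rewrite -dotp_gram gv0 dotpE big1 // => i _; rewrite mxE mul0r.
apply/eqP; rewrite -dotp_eq0 dotp_gram -[vsproj A (gram v)]vsproj_projv vA0 //.
by rewrite capvv memv_proj.
Qed.

(** For [w] in the image of the Gram map, pairing with [w] or with its projection to [A] gives the
    same value; if [w] is orthogonal to [A], then [dotp w w] vanishes. *)
Lemma perp_cap_gram K : (perp A :&: (gram @: K) = 0)%VS.
Proof.
apply/eqP; rewrite -subv0; apply/subvP => w; rewrite memv_cap memv0.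
case/andP=> /perpP wA /memv_imgP[y yK def_w]; move: wA; rewrite {w}def_w => wA.
by rewrite -dotp_eq0 dotp_gram -[vsproj A (gram y)]vsproj_projv -dotp_gram wA // memv_proj.
Qed.

Lemma polarE K : polar f K = (A :&: perp (gram @: (K :&: A)))%VS.
Proof.
apply/vspaceP => v; rewrite memv_cap.
apply/polarP/andP => -[vA H]; split=> //.
  by apply/perpP => _ /memv_imgP[u uK ->]; rewrite dotpC dotp_gram hermC expr0 mul1r H.
move=> u uK; rewrite hermC expr0 mul1r /= -dotp_gram dotpC.
by move/perpP: H; apply; apply: memv_img.
Qed.

Lemma perp_polar K : perp (polar f K) = (perp A + gram @: (K :&: A))%VS.
Proof. by rewrite polarE perp_cap perpK. Qed.

(** Rank-nullity for the Gram map on [K :&: A], whose kernel there is the intersection of [K] with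
    the vertex. *)
Lemma dim_polar K :
  (\dim (polar f K) + \dim (K :&: A) = \dim A + \dim (K :&: polar f A))%N.
Proof.
have := dim_perp (polar f K); rewrite perp_polar.
rewrite dimv_disjoint_sum ?perp_cap_gram //.
have := dim_perp A.
have := limg_ker_dim gram (K :&: A).
suff -> : (K :&: A :&: lker gram)%VS = (K :&: polar f A)%VS by dim_lia.
apply/vspaceP => v; rewrite !memv_cap -andbA; congr (_ && _).
apply/andP/idP => [[vA]|vA']; first by rewrite lker_gram.
have vA := subvP (polar_sub f A) v vA'.
by rewrite lker_gram.
Qed.

Lemma polar_line_sub x b :
  x \in A -> b \in (perp A + <[gram x]>)%VS -> (polar f <[x]> <= perp <[b]>)%VS.
Proof.
move=> xA bx; suff: b \in perp (polar f <[x]>).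
  by rewrite memvE /perp orthov_sym.
by rewrite perp_polar (capv_idPl _) -?memvE // limg_line.
Qed.

End Gram.


(** * Passing between sequences and indexed families *)

Lemma card_ord_count (T : Type) (x0 : T) (a : pred T) (s : seq T) m :
  size s = m -> #|[set i : 'I_m | a (nth x0 s i)]| = count a s.
Proof.
move=> <-; rewrite cardsE -sum1_card -sum1_count (big_nth x0) big_mkord.
exact: eq_bigl.
Qed.

Lemma mktuple_nth (T : Type) (x0 : T) (s : seq T) m :
  size s = m -> [tuple nth x0 s i | i < m] = s :> seq T.
Proof.
move=> szs; apply: (@eq_from_nth _ x0) => [|i]; rewrite size_tuple // => lti.
by rewrite (nth_mktuple _ _ (Ordinal lti)).
Qed.

Lemma free_cat_notin (F : fieldType) (vT : vectType F) (X Y : seq vT) x :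
  free (X ++ Y) -> x \in X -> x \notin <<Y>>%VS.
Proof.
rewrite cat_free => /and3P[frX _ /directv_addP dXY] xX; apply/negP => xY.
have := free_not0 frX xX; rewrite -memv0 -dXY memv_cap xY memv_span //.
Qed.

(** * Total polars in a Cayley-Klein space *)

Section CayleyKlein.
Variables (R : realType) (n : nat) (C : cayley_klein R n).
Local Notation V := 'rV[R]_n.+1.
Local Notation A := (ck_A C).
Local Notation r := (ck_r C).
Implicit Types (K L Phi : {vspace V}).

Definition ck_polar K l : {vspace V} := polar (ck_form C l) K.

Lemma ck_A_sub i j : (i <= j)%N -> (j <= r.+1)%N -> (A j <= A i)%VS.
Proof.
move=> leij; elim: j leij => [|j IHj]; first by rewrite leqn0 => /eqP ->.
rewrite leq_eqVlt => /predU1P[-> //|leij lejr].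
apply: subv_trans (IHj leij (ltnW lejr)).
by rewrite -(ck_vertex (c := C)) // polar_sub.
Qed.

Lemma ck_polar_sub K l : (ck_polar K l <= A l)%VS.
Proof. exact: polar_sub. Qed.

Lemma sub_ck_polar K l : (l <= r)%N -> (A l.+1 <= ck_polar K l)%VS.
Proof. by move=> lelr; rewrite -(ck_vertex lelr); apply/polarS/capvSr. Qed.

Lemma ck_polar_decr K i j : (i <= j <= r)%N -> (ck_polar K j <= ck_polar K i)%VS.
Proof.
case/andP; rewrite leq_eqVlt => /predU1P[-> //|ltij lejr].
apply: subv_trans (sub_ck_polar K _); last exact: leq_trans (ltnW ltij) lejr.
by apply: subv_trans (ck_polar_sub K j) (ck_A_sub ltij _); apply: leqW.
Qed.

Lemma dim_ck_polar K l : (l <= r)%N ->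
  (\dim (ck_polar K l) + \dim (K :&: A l) = \dim (A l) + \dim (K :&: A l.+1))%N.
Proof. by move=> lelr; rewrite dim_polar ck_vertex. Qed.

Lemma total_polar_dim_cap K L l : total_polar C K L -> (l <= r)%N ->
  (\dim (ck_polar K l) <= \dim (L :&: ck_polar K l) + \dim (K :&: A l.+1))%N.
Proof.
case=> _ [X [H [[_ XK] cardX XH [phi _ Hphi] ->]]] lelr.
pose P i := (X i <= A l.+1)%VS.
have cardP : (#|P| <= \dim (K :&: A l.+1))%N.
  move: lelr; rewrite leq_eqVlt => /predU1P[lr|ltlr].
    (* The counting condition stops at level [r]; at level [r.+1] the subspace is zero and contains
       no point. *)
    rewrite eq_card0 // => i; apply/negbTE; rewrite unfold_in /P lr ck_Alast subv0.
    by have [dX _ _] := XH i; rewrite -dimv_eq0 dX.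
  by rewrite -(cardX l.+1 ltlr) cardsE.
apply: leq_trans (dim_cap_hyperplanes P phi (ck_polar K l)) _.
apply: leq_add cardP; apply: dimvS; rewrite subv_cap capvSl andbT.
apply/subv_bigcapP => i _; case: (boolP (P i)) => Pi.
  apply: subv_trans (capvSr _ _) _; rewrite Hphi; exact: (bigcapv_inf i).
apply: subv_trans (capvSl _ _) _.
have [_ _ [j [lejr XAj _ polH]]] := XH i.
apply: subv_trans polH.
have lejl : (j <= l)%N.
  rewrite leqNgt; apply: contra Pi => ltlj.
  by apply: subv_trans XAj (ck_A_sub ltlj _); apply: leqW.
apply: subv_trans (ck_polar_decr K (i := j) _) _; first by rewrite lejl.
by apply: polarS; apply: subv_trans (capvSl _ _) (XK i).
Qed.

(** Induction on [l]: [xs] is a basis of [K] modulo [K :&: A l], and [bs] lists normal vectors of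
    the paired hyperplanes. Keeping [bs] in [perp (A l)] lets its span serve as [U] when
    [adapted_bases] is applied to the Gram map of level [l]. *)
Lemma adapted_sequences K Phi :
    (forall l, (l <= r)%N ->
      (\dim K <= \dim (Phi :&: perp (ck_polar K l)) + \dim (K :&: A l.+1))%N) ->
  forall l, (l <= r.+1)%N -> exists xs bs : seq V,
    [/\ size xs = size bs, basis_of K (xs ++ vbasis (K :&: A l)),
        free bs && (<<bs>> <= Phi :&: perp (A l))%VS,
        forall j, (j <= l)%N ->
          (count [in A j] xs + \dim (K :&: A l) = \dim (K :&: A j))%N &
        forall i, (i < size xs)%N -> exists j,
          [/\ (j <= r)%N, xs`_i \in A j, xs`_i \notin A j.+1 &
              (polar (ck_form C j) <[xs`_i]> <= perp <[bs`_i]>)%VS]].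
Proof.
move=> dimPhi; elim=> [_|l IHl lelr].
  exists [::], [::]; split=> //=.
  - by rewrite ck_A0 capvf vbasisP.
  - by rewrite nil_free span_nil sub0v.
  - by move=> j; rewrite leqn0 => /eqP->.
have [xs [bs [szxb bK /andP[frb sbPhi] countA pairs]]] := IHl (ltnW lelr).
rewrite ltnS in lelr.
set Kl := (K :&: A l)%VS in bK countA; set K' := (K :&: A l.+1)%VS.
have sK'K : (K' <= Kl)%VS by rewrite capvS // ck_A_sub.
have dimb : \dim <<bs>> = size bs := eqP frb.
have szK : (size xs + \dim Kl)%N = \dim K.
  by rewrite -(size_basis_seq bK) size_cat size_tuple.
have sperp : (perp (A l) <= perp (ck_polar K l))%VS.
  exact/perpS/ck_polar_sub.
have sUT : (<<bs>> <= Phi :&: perp (ck_polar K l))%VS.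
  by apply: subv_trans sbPhi (capvS _ _).
have := dimPhi l lelr; rewrite -/K' => leK.
(* The dimension of [M] allows one new normal vector for each new point; it equals
   [\dim K - \dim K'], which [leK] bounds. *)
have [|M /andP[sUM sMPhi] dimM] :=
    subv_between (d := (\dim <<bs>> + (\dim Kl - \dim K'))%N) sUT.
  by have := dimvS sK'K; dim_lia.
have [||||X [Y [szXY bX bY pairXY]]] :=
  @adapted_bases _ _ _ (gram (ck_form C l)) Kl K' M (perp (A l)) <<bs>> sK'K.
- apply/subvP => _ /memv_imgP[v vK' ->].
  (* [K'] lies in the vertex of the quadric of level [l], which the Gram map kills. *)
  suff /eqP-> : gram (ck_form C l) v == 0 by rewrite mem0v.
  have vA : v \in A l by have := subvP sK'K v vK'; rewrite memv_cap => /andP[].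
  rewrite -memv_ker lker_gram // ck_vertex //.
  by move: vK'; rewrite memv_cap => /andP[].
- apply: subv_trans sMPhi _; rewrite -perp_polar; exact: capvSr.
- rewrite subv_cap sUM; exact: subv_trans sbPhi (capvSr _ _).
  by have := dimvS sK'K; dim_lia.
have XK x : x \in X -> x \in Kl by move=> xX; rewrite (basis_mem bX) // mem_cat xX.
have XA x : x \in X -> x \in A l by move/XK; rewrite memv_cap => /andP[].
have XnA x : x \in X -> x \notin A l.+1.
  move=> xX; have := free_cat_notin (basis_free bX) xX.
  rewrite (span_basis (vbasisP K')) memv_cap negb_and.
  by have := XK x xX; rewrite memv_cap => /andP[-> _].
have szX : (size X + \dim K')%N = \dim Kl.
  by rewrite -(size_basis_seq bX) size_cat size_tuple.
exists (xs ++ X), (bs ++ Y); split.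
- by rewrite !size_cat szxb szXY.
- have -> : K = (<<xs>> + Kl)%VS.
    by rewrite -(span_basis (vbasisP Kl)) -span_cat (span_basis bK).
  rewrite -catA; apply: cat_basis bX.
    have := basis_free bK; rewrite cat_free => /and3P[_ _].
    by rewrite (span_basis (vbasisP _)).
  by rewrite /basis_of eqxx (catl_free (basis_free bK)).
- have := basis_free bY; rewrite !cat_free frb (span_basis (vbasisP _)).
  case/and3P=> -> _ /directv_addP dYb; rewrite /=; apply/andP; split.
    by apply/directv_addP; rewrite capvC.
  rewrite span_cat subv_add; apply/andP; split.
    apply: subv_trans sbPhi (capvS _ (perpS _)) => //.
    by apply: ck_A_sub.
  apply: (@subv_trans _ _ M).
    by rewrite -(span_basis bY) span_cat addvSl.
  by apply: subv_trans sMPhi (capvS _ (perpS _)); rewrite ?sub_ck_polar.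
- move=> j; rewrite leq_eqVlt count_cat => /predU1P[->|lejl].
    have -> : count [in A l.+1] X = 0%N.
      by apply/eqP; rewrite -leqn0 leqNgt -has_count -all_predC; apply/allP => x /XnA.
    (* The invariant at [j = l] says that no earlier vector lies in [A l], hence none in
       [A l.+1]. *)
    have : (count [in A l.+1] xs <= count [in A l] xs)%N.
      by apply: sub_count => x; apply/subvP; rewrite ck_A_sub.
    have := countA l (leqnn l); rewrite -/Kl -/K'. lia.
  rewrite -countA //.
  have -> : count [in A j] X = size X.
    apply/eqP; rewrite -all_count; apply/allP => x /XA.
    by apply/subvP/ck_A_sub => //; apply: leqW.
  by rewrite -addnA -szX.
move=> i; rewrite size_cat => ltix.
have catE (s t : seq V) : size s = size xs ->
    (s ++ t)`_i = if (i < size xs)%N then s`_i else t`_(i - size xs).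
  by move=> <-; apply: nth_cat.
rewrite !catE //; case: ltnP => [|lexi]; first exact: pairs.
have ltiX : (i - size xs < size X)%N by rewrite ltn_subLR.
exists l; split=> //.
- by rewrite XA // mem_nth.
- by rewrite XnA // mem_nth.
by apply: polar_line_sub; rewrite ?XA ?mem_nth // pairXY.
Qed.

Lemma total_polarP K L :
  total_polar C K L <->
  (\dim L + \dim K = n.+1)%N /\
  forall l, (l <= r)%N ->
    (\dim (ck_polar K l) - \dim (K :&: A l.+1) <= \dim (L :&: ck_polar K l))%N.
Proof.
split=> [tpKL | [dimLK dimLT]].
  split=> [|l lelr]; first by case: tpKL.
  by have := total_polar_dim_cap tpKL lelr; lia.
have [l lelr||xs [bs [szxb bK /andP[frb]]]] :=
    @adapted_sequences K (perp L) _ r.+1.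
(* Here [Phi] is [perp L]: the bound on [L :&: ck_polar K l] turns into one on the orthogonal of the
   sum. *)
- rewrite -perpD.
  have := dim_perp (L + ck_polar K l); have := dimv_sum_cap L (ck_polar K l).
  have := dimLT l lelr; have := dimvS (sub_ck_polar K lelr).
  have := dimvS (capvSr K (A l.+1)); dim_lia.
- by [].
rewrite ck_Alast capv0 in bK *; rewrite subv_cap => /andP[sbL _] countA pairs.
have szx : size xs = \dim K.
  by rewrite -(size_basis_seq bK) size_cat size_tuple dimv0 addn0.
have szb : size bs = \dim K by rewrite -szxb.
split=> //.
exists (fun i => <[xs`_i]>%VS), (fun i => perp <[bs`_i]>); split.
- split.
    exists (fun i : 'I_(\dim K) => xs`_i) => //.
    by rewrite mktuple_nth ?(catl_free (basis_free bK)).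
  by move=> i; rewrite -memvE (basis_mem bK) // mem_cat mem_nth // szx.
- move=> j lejr; rewrite -countA ?leqW // dimv0 addn0.
  by rewrite -(card_ord_count 0 [in A j] szx); apply: eq_card => i; rewrite !inE.
- move=> i; have ltix : (i < size xs)%N by rewrite szx.
  split.
  + by rewrite dim_vline (free_not0 (catl_free (basis_free bK))) ?mem_nth.
  + have := dim_perp <[bs`_i]>.
    rewrite dim_vline (free_not0 frb) ?mem_nth ?szb // addn1 => ->.
    by rewrite dimvf /dim /= mul1n.
  + by have [j [lejr xA xnA polb]] := pairs i ltix; exists j.
- exists (fun i : 'I_(\dim K) => covec bs`_i).
    by apply: covec_free; rewrite mktuple_nth.
  by move=> i; rewrite lker_covec.
have bperp i : bs`_i \in perp L.
  case: (ltnP i (size bs)) => [lti|?]; last by rewrite nth_default ?mem0v.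
  by rewrite (subvP sbL) // memv_span // mem_nth.
have sL : (L <= \bigcap_(i < \dim K) perp <[bs`_i]>)%VS.
  apply/subv_bigcapP => i _.
  by rewrite /perp orthov_sym -memvE; apply: bperp.
(* Equality follows by dimension: the intersection lies in [perp <<bs>>], and [bs] is free of length
   [\dim K]. *)
apply/eqP; rewrite eqEdim sL /=.
have sb : (\bigcap_(i < \dim K) perp <[bs`_i]> <= perp <<bs>>)%VS.
  rewrite /perp orthov_sym; apply/span_subvP => _ /(nthP 0)[i lti <-].
  rewrite szb in lti; rewrite memvE orthov_sym -/(perp _).
  exact: (bigcapv_inf (Ordinal lti)).
apply: leq_trans (dimvS sb) _.
have := dim_perp <<bs>>; rewrite (eqP frb) szb.
dim_lia.
Qed.

End CayleyKlein.

Theorem theorem3p9 (R : realType) (n : nat) (C : cayley_klein R n)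
    (K : {vspace 'rV[R]_n.+1}) :
  is_schubert_variety (total_polar C K).
Proof.
pose e l := (\dim (ck_polar C K l) - \dim (K :&: ck_A C l.+1))%N.
have leA l : (l <= ck_r C)%N -> (\dim (K :&: ck_A C l.+1) <= \dim (ck_polar C K l))%N.
  by move=> lelr; apply: dimvS; apply: subv_trans (capvSr _ _) (sub_ck_polar K lelr).
have decK l : (l < ck_r C)%N ->
    (\dim (K :&: ck_A C l.+2) <= \dim (K :&: ck_A C l.+1))%N.
  by move=> ltlr; rewrite dimvS // capvS // ck_A_sub.
have e_decr l : (l < ck_r C)%N -> (e l.+1 <= e l)%N.
  (* By [dim_ck_polar], [e l.+1] is [\dim (A l.+1) - \dim (K :&: A l.+1)], while [ck_polar K l]
     contains [A l.+1]. *)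
  move=> ltlr; have := dim_ck_polar K ltlr; have := leA _ (ltnW ltlr).
  have := dimvS (sub_ck_polar K (ltnW ltlr)); rewrite /e; lia.
have [||||W pathW condW] :=
    @is_schubert_variety_of_conditions _ _ (ck_r C) (ck_polar C K) e.
- by move=> l ltlr; apply: ck_polar_decr; rewrite leqnSn.
- exact: e_decr.
- move=> l ltlr; have := (leA _ ltlr, leA _ (ltnW ltlr), decK _ ltlr, e_decr _ ltlr).
  rewrite /e => -[[[]]]; lia.
- exact: leq_subr.
exists W => // L; rewrite -condW total_polarP.
(* At level 0 the ambient [A 0] is the whole space, so [dim_ck_polar] gives
   [e 0 = n.+1 - \dim K]. *)
suff -> : (\dim L + \dim K = n.+1)%N <-> \dim L = e 0%N by [].
have := dim_ck_polar K (leq0n (ck_r C)); rewrite ck_A0 capvf dimvf /dim /= mul1n.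
have := leA _ (leq0n (ck_r C)); rewrite /e; lia.
Qed.
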